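(* Let $\delta>0$, let $\mathcal{B}$ be a $\delta$-share bandwidth allocation game, and let $$\alpha_\delta^u := w\cdot\frac{\ln(w)-w+\delta+1}{\delta},\qquad w=-\tfrac12 W_{-1}\left(-2e^{-\delta-2}\right).$$ For every $\alpha\ge\alpha_\delta^u$, the game $\mathcal{B}$ reaches an $\alpha$-approximate pure Nash equilibrium after a finite number of $\alpha$-moves; that is, from any initial strategy profile, every sequence of successive $\alpha$-moves is finite, and when it cannot be continued the current profile is an $\alpha$-approximate pure Nash equilibrium.
   Context: $W_{-1}$ is the lower branch of the Lambert $W$ function (the inverse of $x\mapsto xe^x$ on $(-\infty,-1]$). A bandwidth allocation game (BAG) is a tuple $(\mathcal{N},\mathcal{R},(b_r)_{r\in\mathcal{R}},(\mathcal{S}_i)_{i\in\mathcal{N}})$ with a set of players $\mathcal{N}=\{1,\dots,n\}$, a set of resources $\mathcal{R}=\{r_1,\dots,r_m\}$, a capacity $b_r>0$ for each resource $r$, and for each player $i$ a finite nonempty strategy space $\mathcal{S}_i\subset\mathbb{R}_{\ge 0}^m$. A strategy $s_i=(s_i(r_1),\dots,s_i(r_m))\in\mathcal{S}_i$ has demand $s_i(r)$ on resource $r$. A strategy profile is ${\sf s}=(s_1,\dots,s_n)\in\mathcal{S}=\mathcal{S}_1\times\dots\times\mathcal{S}_n$. The utility of player $i$ from resource $r$ is $u_{i,r}({\sf s})=\min\left(s_i(r),\frac{b_r\, s_i(r)}{\sum_{j\in\mathcal{N}}s_j(r)}\right)$ (equal to $0$ if $s_i(r)=0$), and her total utility is $u_i({\sf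 s})=\sum_{r\in\mathcal{R}}u_{i,r}({\sf s})$. For $\delta>0$ the game is a $\delta$-share BAG if $s_i(r)\le\delta b_r$ for every player $i$, every $s_i\in\mathcal{S}_i$ and every resource $r$. $({\sf s}_{-i},s_i')$ denotes the profile obtained from ${\sf s}$ by replacing $i$'s strategy with $s_i'$. Let $\alpha\ge1$. An $\alpha$-move is a switch of one player $i$ in a profile ${\sf s}$ from $s_i$ to a strategy $s_i'\in\mathcal{S}_i$ with $\alpha\cdot u_i({\sf s})<u_i({\sf s}_{-i},s_i')$. A profile ${\sf s}$ is an $\alpha$-approximate pure Nash equilibrium if $\alpha\cdot u_i({\sf s})\ge u_i({\sf s}_{-i},s_i')$ for all $i\in\mathcal{N}$ and $s_i'\in\mathcal{S}_i$. *)

(* Defs.v *)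
From HB Require Import structures.
From mathcomp Require Import all_boot all_order all_algebra finmap.
From mathcomp Require Import all_classical all_reals all_analysis.

Set Implicit Arguments.
Unset Strict Implicit.
Unset Printing Implicit Defensive.

Import Order.TTheory GRing.Theory Num.Theory.

Local Open Scope classical_set_scope.
Local Open Scope ring_scope.

(* The lower branch W_{-1} of the Lambert W function. The map x |-> x e^x is a
   bijection from ]-oo, -1] to [-1/e, 0[; outside the latter interval the
   value is the default 0. As 0 < 2 e^(-delta-2) < 1/e for every delta >= 0,
   that default plays no role in alpha_u below. *)
Definition lambertWm1 (R : realType) (y : R) : R :=
  'pinv_(fun=> 0) [set x : R | x <= -1] (fun x : R => x * expR x) y.

Definition alpha_u (R : realType) (delta : R) : R :=
  let w := - 2^-1 * lambertWm1 (- 2 * expR (- delta - 2)) in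
  w * ((ln w - w + delta + 1) / delta).

Record bag (R : realType) (n m : nat) := Bag {
  capacity : 'I_m -> R;
  strategies : 'I_n -> {fset 'rV[R]_m};
  capacity_gt0 : forall r, 0 < capacity r;
  strategies_neq0 : forall i, strategies i != fset0;
  strategies_ge0 : forall i (x : 'rV[R]_m) r, x \in strategies i -> 0 <= x 0 r
}.

Section Game.
Variables (R : realType) (n m : nat) (B : bag R n m).

Definition profile := forall i : 'I_n, strategies B i.

Definition demand (s : profile) (i : 'I_n) (r : 'I_m) : R := val (s i) 0 r.

(* When demand s i r = 0 this is 0, even if the total demand on r is 0, because
   0^-1 = 0. *)
Definition resource_utility (s : profile) (i : 'I_n) (r : 'I_m) : R :=
  Num.min (demand s i r)
    (capacity B r * demand s i r / \sum_(j < n) demand s j r).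

Definition utility (s : profile) (i : 'I_n) : R :=
  \sum_(r < m) resource_utility s i r.

Definition is_share_bag (delta : R) :=
  forall i (x : 'rV[R]_m) r,
    x \in strategies B i -> x 0 r <= delta * capacity B r.

(* The profile (s_{-i}, x). *)
Definition deviate (s : profile) (i : 'I_n) (x : strategies B i) : profile :=
  eqtype.dfwith s x.

Definition alpha_move (alpha : R) (s s' : profile) :=
  exists i (x : strategies B i),
    s' = deviate s x /\ alpha * utility s i < utility (deviate s x) i.

Definition approx_pure_nash (alpha : R) (s : profile) :=
  forall i (x : strategies B i),
    utility (deviate s x) i <= alpha * utility s i.

(* p 0, ..., p N is a sequence of N successive alpha-moves starting from s; the
   values of p beyond N are irrelevant. *)
Definition finite_moves (alpha : R) (s : profile) (p : nat -> profile)
    (N : nat) :=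
  p 0%N = s /\ forall k, (k < N)%N -> alpha_move alpha (p k) (p k.+1).

Definition infinite_moves (alpha : R) (s : profile) (p : nat -> profile) :=
  p 0%N = s /\ forall k, alpha_move alpha (p k) (p k.+1).

End Game.

(* Main.v *)
(** The potential is the sum over resources of the integral of the per-unit
    utility [min 1 (b_r / x)] for [x] from [0] to the total demand on [r]. As
    that integrand is nonincreasing, a player leaving a resource with utility
    [u] lowers the potential by at least [u]; on a [delta]-share game the loss
    is at most [alpha_u delta * u], since the ratio is largest when the demand
    of the leaving player is [delta * b_r] and the total demand is [w * b_r],
    [w] being the root above [1] of [ln w = 2 * w - 2 - delta]. Hence an
    [alpha]-move strictly increases the potential, which takes finitely many
    values. *)
Require Import Defs.
From mathcomp Require Import all_boot all_order all_algebra finmap.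
From mathcomp Require Import all_classical all_reals all_analysis.
From mathcomp Require Import ring lra.

Import Order.TTheory GRing.Theory Num.Theory.
Import numFieldNormedType.Exports.

Local Open Scope ring_scope.

(** * Logarithm bounds and the root [w] behind [alpha_u] *)

Lemma ln_le_tangent {R : realType} (w x : R) :
  0 < w -> 0 < x -> ln x <= ln w + (x / w - 1).
Proof.
move=> w0 x0; rewrite -lerBlDl -ln_div ?posrE//.
rewrite [leLHS](_ : _ = ln (1 + (x / w - 1))); last by congr ln; ring.
by apply: le_ln1Dx; rewrite ltrBrDl subrr divr_gt0.
Qed.

Lemma ln_ge_1BV {R : realType} (x : R) : 0 < x -> 1 - x^-1 <= ln x.
Proof.
by move=> x0; have := ln_le_tangent _ _ x0 ltr01; rewrite ln1 div1r; lra.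
Qed.

(** The pseudo-inverse avoids its default because the argument has a preimage in []-oo, -1]], found
    by the intermediate value theorem between [- 2 - 2 * delta] and [- 2]. *)
Lemma lambertWm1P {R : realType} (delta : R) : 0 < delta ->
  lambertWm1 (- 2 * expR (- delta - 2)) <= -1 /\
  lambertWm1 (- 2 * expR (- delta - 2)) *
    expR (lambertWm1 (- 2 * expR (- delta - 2))) = - 2 * expR (- delta - 2).
Proof.
move=> d0; set f := fun x : R => x * expR x; set y := - 2 * _.
suff yA : (f @` [set x | x <= -1])%classic y.
  split; last exact: (@pinvK _ _ (fun=> 0) _ f) (mem_set yA).
  have := @surjpinv_image_sub _ _ (fun=> 0) [set x : R | x <= -1]%classic
    (f @` [set x | x <= -1])%classic f (fun _ => id).
  by apply; exists y.
have f_cont : continuous f.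
  by move=> x; apply: continuousM; [exact: id|exact: continuous_expR].
have f2 : f (-2) <= y.
  by rewrite /f /y !mulNr lerN2 ler_pM2l// ler_expR; lra.
(* This end point works because [1 + delta <= expR delta]. *)
have f2d : y <= f (- 2 - 2 * delta).
  rewrite /f /y (_ : - 2 - 2 * delta = - 2 * (1 + delta)); last by ring.
  rewrite -mulrA !mulNr lerN2 ler_pM2l//.
  rewrite (_ : - (2 * _) = - delta + (- delta - 2)); last by ring.
  rewrite [X in _ * X]expRD mulrA ler_piMl ?expR_ge0//.
  by rewrite expRN ler_pdivrMr ?expR_gt0// mul1r expR_ge1Dx.
have le2 : - 2 - 2 * delta <= - 2 by lra.
have [|x xI fx] := @IVT _ f _ _ y le2 (continuous_subspaceT f_cont).
  by rewrite ge_min le_max f2 f2d !orbT.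
by exists x => //=; move: xI; rewrite in_itv => /andP[_ /= xle]; lra.
Qed.

(** Putting [W = - 2 * w] in the equation of [lambertWm1P] and taking logarithms gives the equation
    for [ln w], which reduces [ln w - w + delta + 1] to [w - 1]. *)
Lemma alpha_uE {R : realType} (delta : R) : 0 < delta ->
  exists w, [/\ 1 < w, ln w = 2 * w - 2 - delta &
    alpha_u delta = w * (w - 1) / delta].
Proof.
move=> d0; have [Wle1 WE] := lambertWm1P _ d0.
rewrite /alpha_u; set W := lambertWm1 _ in Wle1 WE *.
set w := - 2^-1 * W.
have W2 : W = - 2 * w by rewrite /w; field.
have w_ge : 1 / 2 <= w by rewrite /w; lra.
have w0 : 0 < w by lra.
have lnw : ln w = 2 * w - 2 - delta.
  have wE : w = expR (2 * w - 2 - delta).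
    rewrite (_ : 2 * w - 2 - delta = - delta - 2 - W); last by rewrite W2; ring.
    rewrite expRD expRN.
    apply: (mulIf (lt0r_neq0 (expR_gt0 W))); rewrite mulfVK ?gt_eqF ?expR_gt0//.
    by move: WE; rewrite {1}W2; lra.
  by rewrite [in LHS]wE expRK.
(* The branch only yields [1 / 2 <= w]. On [[1/2, 1]], [2 * w - 2 <= 1 - w^-1 <= ln w], against the
   equation for [ln w]. *)
have w1 : 1 < w.
  have := ln_ge_1BV _ w0; rewrite lnw => h.
  rewrite ltNge; apply/negP => w1.
  have : 0 <= (2 * w - 1) * (1 - w) / w.
    by apply: divr_ge0; [apply: mulr_ge0; lra|lra].
  rewrite (_ : _ / w = 3 - 2 * w - w^-1); first by lra.
  by field; rewrite gt_eqF.
by exists w; split => //; rewrite lnw; field; rewrite gt_eqF.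
Qed.

(** * Inequalities on a single resource of capacity 1 *)

(** For [0 <= x], the closed form of the integral of [min 1 t^-1] over [[0, x]]; demands are
    measured in units of the capacity. *)
Definition unit_potential {R : realType} (x : R) : R :=
  if x <= 1 then x else 1 + ln x.

(** The share is [s] times the integrand at [x + s], its least value on the interval of integration
    [[x, x + s]]. *)
Lemma share_le_gain {R : realType} (x s : R) : 0 <= x -> 0 <= s ->
  Num.min s (s / (x + s)) <= unit_potential (x + s) - unit_potential x.
Proof.
move=> x0 s0; rewrite /unit_potential.
case: (leP (x + s) 1) => l1.
  have x1 : x <= 1 by lra.
  by rewrite x1 ge_min addrAC subrr add0r lexx.
have l0 : 0 < x + s by lra.
rewrite ge_min; apply/orP; right.
case: (leP x 1) => x1.
  have := ln_ge_1BV _ l0.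
  (* The slack left once [ln (x + s)] is replaced by its lower bound. *)
  have : 0 <= (1 - x) * (x + s - 1) / (x + s).
    by apply: divr_ge0; [apply: mulr_ge0; lra|lra].
  suff -> : (1 - x) * (x + s - 1) / (x + s)
          = 2 - x - (x + s)^-1 - s / (x + s) by lra.
  by field; rewrite gt_eqF.
have x_gt0 : 0 < x by lra.
have := ln_le_tangent _ _ l0 x_gt0.
suff -> : x / (x + s) = 1 - s / (x + s) by lra.
by field; rewrite gt_eqF.
Qed.

Lemma share_gt1 {R : realType} {x s : R} : 0 <= s -> 1 < x + s ->
  Num.min s (s / (x + s)) = s / (x + s).
Proof.
move=> s0 l1; apply/min_idPr.
by rewrite ler_pdivrMr ?(lt_trans _ l1)// ler_peMr// ltW.
Qed.

(** Settles the case of total demand within the capacity, where gain and share coincide.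
    Substituting [delta = 2 * w - 2 - ln w] and bounding [ln w] below leaves a cube. *)
Lemma alpha_u_ge1 {R : realType} (delta : R) : 0 < delta -> 1 <= alpha_u delta.
Proof.
move=> d0; have [w [w1 lnw ->]] := alpha_uE _ d0.
rewrite ler_pdivlMr// mul1r.
have w0 : 0 < w by lra.
have := ln_ge_1BV _ w0; rewrite lnw.
have : 0 <= (w - 1) ^+ 3 / w.
  by apply: divr_ge0; [apply: exprn_ge0; lra|lra].
suff -> : (w - 1) ^+ 3 / w = w * (w - 1) - (2 * w - 2) + (1 - w^-1) by lra.
by field; rewrite gt_eqF.
Qed.

(** The case that dictates [alpha_u]: one player's demand carries the total across the capacity. The
    bounds [cd] and [hc] are equalities at [s = delta] and [x + s = w]. *)
Lemma gain_crossing {R : realType} (delta x s : R) : 0 < delta ->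
  0 < s <= delta -> x <= 1 <= x + s ->
  1 + ln (x + s) - x <= alpha_u delta * (s / (x + s)).
Proof.
move=> d0 /andP[s0 sd] /andP[x1 l1].
have [w [w1 lnw ->]] := alpha_uE _ d0.
have w0 : 0 < w by lra.
have l0 : 0 < x + s by lra.
have := ln_le_tangent _ _ w0 l0; rewrite lnw.
set l := x + s in l1 l0 *; have -> : x = l - s by rewrite /l; ring.
move=> h.
have lnl : ln l <= l - 1.
  by have := ln_le_tangent _ _ ltr01 l0; rewrite ln1 divr1; lra.
(* [c] is nonpositive, so that [c / s] is at most [c / delta] *)
set c := 1 + ln l - l.
have c0 : c <= 0 by rewrite /c; lra.
have cd : delta * c <= s * c by rewrite ler_wnM2r.
have hc : l * (c + delta) <= w * (w - 1).
  (* This is the tangent of [ln] at [w]; afterwards [l * (2 - l / w)] is largest at [l = w]. *)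
  have e : c + delta <= (w - 1) * (2 - l / w).
    rewrite (_ : (w - 1) * _ = 2 * w - 2 - l + l / w); first by rewrite /c; lra.
    by field; rewrite gt_eqF.
  apply: le_trans (ler_wpM2l (ltW l0) e) _.
  rewrite -subr_ge0.
  rewrite (_ : _ - _ = (w - 1) * (l - w) ^+ 2 / w); last first.
    by field; rewrite gt_eqF.
  by apply: divr_ge0; [apply: mulr_ge0; [lra|exact: sqr_ge0]|lra].
rewrite (_ : 1 + ln l - (l - s) = c + s); last by rewrite /c; ring.
rewrite (_ : _ * (s / l) = s * (w * (w - 1)) / (delta * l)); last first.
  by field; rewrite !gt_eqF.
rewrite ler_pdivlMr ?mulr_gt0//.
apply: le_trans (ler_wpM2l (ltW s0) hc).
by have := ler_wpM2r (ltW l0) cd; lra.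
Qed.

Lemma gain_le_share {R : realType} (delta x s : R) : 0 < delta -> 0 <= x ->
  0 <= s <= delta ->
  unit_potential (x + s) - unit_potential x
    <= alpha_u delta * Num.min s (s / (x + s)).
Proof.
move=> d0 x0 /andP[]; rewrite le_eqVlt => /predU1P[<- _|s0 sd].
  by rewrite addr0 subrr mul0r minxx mulr0.
rewrite /unit_potential; case: (leP (x + s) 1) => l1.
  have x1 : x <= 1 by lra.
  rewrite x1 addrAC subrr add0r min_l; last first.
    by rewrite ler_pdivlMr ?ler_piMr//; lra.
  by rewrite ler_peMl ?alpha_u_ge1//; lra.
rewrite share_gt1 ?(ltW s0)//; case: (leP x 1) => x1.
  by apply: gain_crossing => //; rewrite ?s0// x1 ltW.
have x_gt0 : 0 < x by lra.
have x_neq0 : x != 0 by rewrite gt_eqF.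
(* Both sides depend only on the ratio [s / x]: reduce to [x = 1]. *)
have sx : 0 < s / x <= delta.
  rewrite divr_gt0//= ler_pdivrMr// (le_trans sd)//.
  by rewrite ler_peMr// ltW.
have /(gain_crossing _ 1 _ d0 sx) : (1 : R) <= 1 <= 1 + s / x.
  by rewrite lexx lerDl ltW//; case/andP: sx.
rewrite (_ : 1 + s / x = (x + s) / x); last by field.
rewrite ln_div ?posrE//; last by lra.
rewrite (_ : s / x / _ = s / (x + s)); first by lra.
by field; rewrite x_neq0/= gt_eqF//; lra.
Qed.

(** * The potential of the game and its growth along moves *)

(** The outer factor [capacity B r] comes from the change of variable that rescales the integral to
    capacity 1. *)
Definition potential {R : realType} {n m : nat} {B : bag R n m}
    (s : profile B) : R :=
  \sum_(r < m)
    capacity B r * unit_potential ((\sum_(j < n) demand s j r) / capacity B r).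

Section Potential.
Context {R : realType} {n m : nat} {B : bag R n m}.
Implicit Type s : profile B.

Lemma demand_ge0 s i r : 0 <= demand s i r.
Proof. exact: strategies_ge0 (valP (s i)). Qed.

Definition rest_demand s i r : R := \sum_(j < n | j != i) demand s j r.

Lemma rest_demand_ge0 s i r : 0 <= rest_demand s i r.
Proof. by apply: sumr_ge0 => j _; exact: demand_ge0. Qed.

Lemma total_demandE s i r :
  \sum_(j < n) demand s j r = rest_demand s i r + demand s i r.
Proof. by rewrite (bigD1 i)//= addrC. Qed.

Lemma rest_demand_deviate s i (x : strategies B i) r :
  rest_demand (deviate s x) i r = rest_demand s i r.
Proof.
apply: eq_bigr => j ji; rewrite /demand /deviate eqtype.dfwith_out//.
by rewrite eq_sym.
Qed.

(* The potential once player [i] has withdrawn. *)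
Definition rest_potential s i : R :=
  \sum_(r < m) capacity B r * unit_potential (rest_demand s i r / capacity B r).

Lemma resource_utilityE s i r :
  let b := capacity B r in
  resource_utility s i r = b * Num.min (demand s i r / b)
    (demand s i r / b / (rest_demand s i r / b + demand s i r / b)).
Proof.
move=> b; have b0 : 0 < b by exact: capacity_gt0.
rewrite /resource_utility (total_demandE s i) -/b -mulrDl.
rewrite minr_pMr ?(ltW b0)//; congr Num.min; first by field; rewrite gt_eqF.
(* With zero total demand both sides vanish, since [0^-1 = 0]. *)
have [->|t0] := eqVneq (rest_demand s i r + demand s i r) 0.
  by rewrite mul0r invr0 !mulr0.
by field; rewrite t0 gt_eqF.
Qed.

Lemma utility_ge0 s i : 0 <= utility s i.
Proof.
apply: sumr_ge0 => r _; rewrite le_min demand_ge0/=.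
apply: divr_ge0; last by apply: sumr_ge0 => j _; exact: demand_ge0.
by rewrite mulr_ge0 ?demand_ge0// ltW// capacity_gt0.
Qed.

Lemma utility_le_gain s i : utility s i <= potential s - rest_potential s i.
Proof.
rewrite /potential /rest_potential -sumrB; apply: ler_sum => r _.
have b0 := capacity_gt0 B r.
rewrite resource_utilityE/= (total_demandE s i) -mulrBr ler_pM2l// mulrDl.
by apply: share_le_gain; rewrite divr_ge0 ?rest_demand_ge0 ?demand_ge0 ?ltW.
Qed.

Lemma gain_le_utility delta s i : 0 < delta -> is_share_bag B delta ->
  potential s - rest_potential s i <= alpha_u delta * utility s i.
Proof.
move=> d0 share; rewrite /potential /rest_potential -sumrB mulr_sumr.
apply: ler_sum => r _; have b0 := capacity_gt0 B r.
rewrite resource_utilityE/= (total_demandE s i) -mulrBr mulrCA ler_pM2l// mulrDl.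
apply: gain_le_share => //.
  by rewrite divr_ge0 ?rest_demand_ge0 ?ltW.
rewrite divr_ge0 ?demand_ge0 ?(ltW b0)//= ler_pdivrMr//.
exact: share (valP (s i)).
Qed.

(** Both profiles share the same [rest_potential]. Above it, the old potential exceeds by at most
    [alpha * utility s i], the new one by at least the new utility. *)
Lemma alpha_move_potential delta alpha s s' :
  0 < delta -> is_share_bag B delta -> alpha_u delta <= alpha ->
  alpha_move alpha s s' -> potential s < potential s'.
Proof.
move=> d0 share le_alpha [i [x [-> lt_u]]].
have rest : rest_potential (deviate s x) i = rest_potential s i.
  by apply: eq_bigr => r _; rewrite rest_demand_deviate.
have := utility_le_gain (deviate s x) i; rewrite rest.
have := gain_le_utility _ s i d0 share.
have := ler_wpM2r (utility_ge0 s i) le_alpha.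
by lra.
Qed.

Lemma no_increasing_profiles (p : nat -> profile B) :
  ~ (forall k, potential (p k) < potential (p k.+1)).
Proof.
move=> incr.
have mono : {mono (fun k => potential (p k)) : k l / (k <= l)%N >-> k <= l}.
  by apply: le_mono; apply: homo_ltn incr => ? ? ?; exact: lt_trans.
(* Recast as finite functions, the profiles can be counted. *)
pose f k : {dffun forall i, strategies B i} := [ffun i => p k i].
have f_inj : injective f.
  move=> k l /ffunP fkl; apply: (inc_inj mono).
  suff -> : p k = p l by [].
  by apply: functional_extensionality_dep => i; have := fkl i; rewrite !ffunE.
(* Pigeonhole, with one more index than there are profiles. *)
have := leq_card (fun k : 'I_(#|{dffun forall i, strategies B i}|.+1) => f k) _.
rewrite card_ord ltnn => h; suff : false by [].
by apply: h => k l /f_inj /val_inj.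
Qed.

Lemma not_approx_pure_nash alpha s :
  ~ approx_pure_nash alpha s <-> exists s', alpha_move alpha s s'.
Proof.
split=> [|[s' [i [x [_ lt_u]]]] /(_ i x)]; last by rewrite leNgt lt_u.
move=> /existsNP[i /existsNP[x /negP]]; rewrite -ltNge => lt_u.
by exists (deviate s x), i, x.
Qed.

End Potential.

Theorem theorem4p2 (R : realType) (n m : nat) (delta : R) (B : bag R n m)
    (alpha : R) (delta_gt0 : 0 < delta) (share : is_share_bag B delta)
    (le_alpha : alpha_u delta <= alpha) (s0 : profile B) :
  [/\ exists (p : nat -> profile B) (N : nat),
        finite_moves alpha s0 p N /\ approx_pure_nash alpha (p N),
      ~ (exists p : nat -> profile B, infinite_moves alpha s0 p)
    & forall (p : nat -> profile B) (N : nat),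
        finite_moves alpha s0 p N ->
        ~ (exists s : profile B, alpha_move alpha (p N) s) ->
        approx_pure_nash alpha (p N)].
Proof.
have no_inf (p : nat -> profile B) :
    ~ (forall k, alpha_move alpha (p k) (p k.+1)).
  move=> moves; apply: (no_increasing_profiles p) => k.
  exact: alpha_move_potential share le_alpha (moves k).
split; last 2 first.
- by move=> [p [_ /no_inf]].
- move=> p N _ stuck; apply: contrapT.
  by move=> /not_approx_pure_nash.
(* The implication makes [step] total, hence iterable; at an equilibrium its value is arbitrary. *)
have next (s : profile B) :
    exists s', ~ approx_pure_nash alpha s -> alpha_move alpha s s'.
  have [nash|/not_approx_pure_nash[s' mv]] := pselect (approx_pure_nash alpha s).
    by exists s.
  by exists s'.
have [step stepP] := choice next.
pose p k := iter k step s0.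
have exN : exists k, `[< approx_pure_nash alpha (p k) >].
  apply: contrapT => /forallNP no_nash; apply: (no_inf p) => k.
  by apply: stepP => nash; apply: (no_nash k); exact/asboolP.
(* Minimality of [N] ensures that every earlier step is a genuine move. *)
case: (ex_minnP exN) => N /asboolP nashN minN.
exists p, N; split => //; split => // k kN; apply: stepP => nash.
by move: kN; rewrite ltnNge minN//; exact/asboolP.
Qed.
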